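(* (i) Let $(\Omega,\Sigma)$ be a measurable space, $\{E_\theta\}_{\theta\in\Theta}\subseteq\Sigma$ a regular chain, $\mathcal Z=\prod_{i=1}^n\mathcal Z_i$ a finite product of measurable spaces, and $\{\mu_z\}_{z\in\mathcal Z}$ a family in $\mathrm{ca}(\Omega,\Sigma)$ that is order bounded from below, satisfies $\|\mu_z\|\le1$ for all $z\in\mathcal Z$, and is such that $z\mapsto\mu_z(E_\theta)$ is measurable for each $\theta\in\Theta$. Let $Z$ be a random vector in $\mathcal Z$ with independent components. Then the cumulative function $F_Z(\theta):=\mu_Z(E_\theta)$, $\theta\in\Theta$, is equivalent to a member $f_Z$ of $\mathcal M$. The member $f_Z$ may be chosen with effective sample size $$\eta_f=(1+\|\nu\|)^2\,\eta_F,\qquad \nu:=\bigwedge_{z\in\mathcal Z}\mu_z .$$ (ii) Conversely, every member of $\mathcal M$ is equivalent to a cumulative function of a randomised signed measure along a regular chain, satisfying all the hypotheses of (i), with $\nu=0$.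
   Context: **Randomised functions.** Let $n\ge 1$, let $\mathcal Z_1,\dots,\mathcal Z_n$ be measurable spaces with product $\mathcal Z$, let $\Theta$ be a non-empty index set, and let $f\colon\mathcal Z\times\Theta\to\mathbb R$ be bounded and such that for every $\theta$ the section $f_\theta(z):=f(z,\theta)$ is measurable in $z$. Write $f_z(\theta):=f(z,\theta)$. For a random vector $Z=(Z_1,\dots,Z_n)$ with independent components, $Z_i$ valued in $\mathcal Z_i$, the random map $f_Z\colon\Theta\to\mathbb R$ is a randomised function, and $(f,Z)$ a randomisation. Put $c_i(f):=\sup_{\theta,\,z_i^*\in\mathcal Z_i,\,z\in\mathcal Z}|f_\theta(z_i^*,z_{-i})-f_\theta(z)|$ ($(z_i^*,z_{-i})$ is $z$ with $i$-th coordinate replaced by $z_i^*$) and the effective sample size $\eta_f:=(\sum_i c_i(f)^2)^{-1}\in(0,\infty]$ (with $1/0=\infty$). **The class $\mathcal M$.** $\mathcal M$ is the class of all randomisations $(f,Z)$ with index set $\mathbb R$ (over all finite products of measurable spaces) such that for every $z\in\mathcal Z$ the function $f_z\colon\mathbb R\to[0,1]$ is non-decreasing with values in $[0,1]$; one writes $f_Z\in\mathcal M$. **Equivalence.** Two randomised functions $f_Z\colon\Theta\to\mathbb R$ and $g_Z\colon T\to\mathbb R$ over a common product measurable space $\mathcal Z$ and the same random vector $Z$ are equivalent if $\eta_f=\eta_g=\infty$ or $$\sqrt{\eta_f}\sup_{\theta\in\Theta}|f(z,\theta)-\mathbb E[f_Z(\theta)]|=\sqrt{\eta_g}\sup_{t\in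 T}|g(z,t)-\mathbb E[g_Z(t)]|\quad\text{for each }z\in\mathcal Z.$$ **Regular chain.** An indexed family $\{E_\theta\}_{\theta\in\Theta}\subseteq\Sigma$ is a regular chain if (1) for all $\theta,\theta^*\in\Theta$ either $E_\theta\subseteq E_{\theta^*}$ or $E_{\theta^*}\subseteq E_\theta$; and (2) there is a positive, finite, finitely additive measure $\lambda$ on $(\Omega,\Sigma)$ such that $\theta\neq\theta^*$ implies $\lambda(E_\theta\triangle E_{\theta^*})>0$. **Signed measures.** $\mathrm{ca}(\Omega,\Sigma)$ is the Dedekind complete Banach lattice of finite countably additive signed measures on $(\Omega,\Sigma)$ with total variation norm $\|\cdot\|$ and setwise order; $\bigwedge$ denotes the infimum in this lattice. Order bounded from below means there is $\kappa\in\mathrm{ca}(\Omega,\Sigma)$ with $\kappa\le\mu_z$ for all $z$. $F_Z(\theta)=\mu_Z(E_\theta)$ is called the cumulative function of the randomised signed measure $\mu_Z$ along the chain, and $\eta_F$ is the effective sample size of $F(z,\theta)=\mu_z(E_\theta)$. *)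

(* Defs.v *)
From HB Require Import structures.
From mathcomp Require Import all_boot all_order all_algebra.
From mathcomp Require Import all_classical all_reals all_analysis.

Set Implicit Arguments.
Unset Strict Implicit.
Unset Printing Implicit Defensive.

Import Order.TTheory GRing.Theory Num.Theory.
Import numFieldNormedType.Exports.

Local Open Scope classical_set_scope.
Local Open Scope ring_scope.

Section product_space.
Context (n : nat) (d : 'I_n -> measure_display)
  (Z : forall i, measurableType (d i)).

Definition cylinders : set (set (forall i, Z i)) :=
  \bigcup_i preimage_set_system setT (fun z : forall i, Z i => z i) measurable.

(* The product sigma-algebra, also when the factors are different spaces (the
   library only has it for binary products and for tuples over one space). *)
Definition prodspace := g_sigma_algebraType cylinders.

End product_space.

Section randomised_functions.
Context (R : realType) (n : nat) (d : 'I_n -> measure_display)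
  (Z : forall i, measurableType (d i)).
Local Open Scope ereal_scope.

Definition independent_components dW (W : measurableType dW)
    (P : probability W R) (X : {RV P >-> prodspace Z}) : Prop :=
  forall (J : {set 'I_n}) (A : forall i, set (Z i)),
    (forall i, measurable (A i)) ->
    P (\bigcap_(i in [set` J]) [set w | A i (X w i)]) =
    \prod_(i in J) P [set w | A i (X w i)].

(* [(f, X)] is a randomisation with index set [Theta] and [f_theta(z)] written
   [f z theta]. *)
Definition randomisation dW (W : measurableType dW) (P : probability W R)
    (X : {RV P >-> prodspace Z}) (Theta : Type)
    (f : prodspace Z -> Theta -> R) : Prop :=
  [/\ inhabited Theta,
      exists M : R, forall z t, (`|f z t| <= M)%R,
      forall t, measurable_fun setT (fun z => f z t) &
      independent_components X].

(* Extended-real valued so that no boundedness is presupposed; [dfwith z i a]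
   is [z] with its [i]-th coordinate replaced by [a]. *)
Definition oscillation (Theta : Type) (f : prodspace Z -> Theta -> R)
    (i : 'I_n) : \bar R :=
  ereal_sup [set x | exists (t : Theta) (a : Z i) (z : prodspace Z),
    x = `|f (dfwith z i a) t - f z t|%:E].

(* The inverse on [\bar R] satisfies [0^-1 = +oo]. *)
Definition sample_size (Theta : Type) (f : prodspace Z -> Theta -> R) : \bar R :=
  (\sum_(i < n) oscillation f i ^+ 2)^-1.

Definition deviation dW (W : measurableType dW) (P : probability W R)
    (X : {RV P >-> prodspace Z}) (Theta : Type)
    (f : prodspace Z -> Theta -> R) (z : prodspace Z) : \bar R :=
  ereal_sup [set `|(f z t)%:E - 'E_P[fun w => f (X w) t]| | t in [set: Theta]].

Definition equivalent dW (W : measurableType dW) (P : probability W R)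
    (X : {RV P >-> prodspace Z}) (Theta T : Type)
    (f : prodspace Z -> Theta -> R) (g : prodspace Z -> T -> R) : Prop :=
  [/\ randomisation X f, randomisation X g &
      (sample_size f = +oo /\ sample_size g = +oo) \/
      (forall z, sqrte (sample_size f) * deviation X f z =
                 sqrte (sample_size g) * deviation X g z)].

Definition classM dW (W : measurableType dW) (P : probability W R)
    (X : {RV P >-> prodspace Z}) (f : prodspace Z -> R -> R) : Prop :=
  [/\ randomisation X f,
      forall z t, (0 <= f z t <= 1)%R &
      forall z, {homo f z : s t / (s <= t)%R}].

End randomised_functions.

Section signed_measures.
Context (R : realType) dO (Omega : measurableType dO).
Local Open Scope ereal_scope.
Implicit Types mu nu kappa : {charge set Omega -> \bar R}.

Definition charge_le kappa mu : Prop :=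
  forall A, measurable A -> kappa A <= mu A.

Definition charge_lower_bound (I : Type)
    (mu : I -> {charge set Omega -> \bar R}) kappa : Prop :=
  forall i, charge_le kappa (mu i).

Definition charge_inf (I : Type)
    (mu : I -> {charge set Omega -> \bar R}) nu : Prop :=
  charge_lower_bound mu nu /\
  forall kappa, charge_lower_bound mu kappa -> charge_le kappa nu.

Definition hahn_pos mu : set Omega := projT1 (cid (Hahn_decomposition mu)).

Definition hahn_neg mu : set Omega :=
  projT1 (cid (projT2 (cid (Hahn_decomposition mu)))).

Lemma hahn_pos_neg mu : hahn_decomposition mu (hahn_pos mu) (hahn_neg mu).
Proof. exact: (projT2 (cid (projT2 (cid (Hahn_decomposition mu))))). Qed.

(* The total variation norm; it does not depend on the chosen Hahn
   decomposition. *)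
Definition charge_norm mu : \bar R := charge_variation (hahn_pos_neg mu) setT.

Definition regular_chain (Theta : Type) (E : Theta -> set Omega) : Prop :=
  [/\ forall t, measurable (E t),
      forall s t, E s `<=` E t \/ E t `<=` E s &
      exists lambda : {content set Omega -> \bar R},
        fin_num_fun lambda /\
        forall s t, s <> t -> 0 < lambda (E s `+` E t)].

End signed_measures.

Section cumulative_functions.
Context (R : realType) (n : nat) (d : 'I_n -> measure_display)
  (Z : forall i, measurableType (d i)) dO (Omega : measurableType dO)
  (Theta : Type) (E : Theta -> set Omega)
  (mu : prodspace Z -> {charge set Omega -> \bar R}).
Local Open Scope ereal_scope.

Definition cumulative_function (z : prodspace Z) (t : Theta) : R := fine (mu z (E t)).

Definition cumulative_setting : Prop :=
  [/\ inhabited Theta,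
      regular_chain R E,
      exists kappa, charge_lower_bound mu kappa,
      forall z, charge_norm (mu z) <= 1 &
      forall t, measurable_fun setT (fun z => cumulative_function z t)].

End cumulative_functions.

(* Main.v *)
(* For (i), the infimum of the family is A |-> inf s(A), where s runs over the
   charges obtained from the family by pasting s1 on B and s2 off B. Closure under
   pasting makes this infimum finitely additive, and being squeezed between a lower
   bound and a member it is countably additive. With phi(theta) = lambda(E_theta),
   the chain is order embedded in the real line, and
   h(z, theta) = (mu_z - nu)(E_theta) / (1 + ||nu||) is extended by
   f(z, x) = sup ({0} U {h(z, theta) : phi(theta) <= x}). Shifting by nu(E_theta)
   changes neither the oscillations nor the deviation, dividing scales them, and
   every f(., x) is 0 or a pointwise limit of sections of h, so that the extension
   does not change them either.

   For (ii), disjoint fibres {z} x [0, 1] carry Lebesgue measures m_z, and E_t is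
   the subgraph {(z, x) : 0 <= x < f(z, t)}, so that m_z(E_t) = f(z, t) is countably
   additive whatever the jumps of f(z, .). One more fibre with a strictly increasing
   function in place of f(z, .) makes the chain regular. Finally m_z is replaced by
   m_z - nu, where nu is the infimum of the m_z. *)

Require Import Defs.
From HB Require Import structures.
From mathcomp Require Import all_boot all_order all_algebra.
From mathcomp Require Import all_classical all_reals all_analysis.
From mathcomp Require Import measurable_realfun ring.

Set Implicit Arguments.
Unset Strict Implicit.
Unset Printing Implicit Defensive.

Import Order.TTheory GRing.Theory Num.Theory.
Import numFieldNormedType.Exports.

Local Open Scope classical_set_scope.
Local Open Scope ring_scope.
Local Open Scope ereal_scope.

(** * Behaviour of oscillations, sample sizes and deviations under affine changes *)

Section randomisations.
Context {R : realType} {n : nat} {d : 'I_n -> measure_display}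
  {Z : forall i, measurableType (d i)} {dW : measure_display}
  {W : measurableType dW} {P : probability W R} {X : {RV P >-> prodspace Z}}.

Lemma randomisation_integrable {T : Type} {f : prodspace Z -> T -> R} (t : T) :
  randomisation X f -> P.-integrable setT (EFin \o (fun w => f (X w) t)).
Proof.
move=> [_ [M fM] mf _].
apply: measurable_bounded_integrable => //.
- by rewrite -ge0_fin_numE// fin_num_measure.
- exact: (measurableT_comp (mf t) (measurable_funPT X)).
- exists M; split; first exact: num_real.
  by move=> x Mx w _ /=; apply: (le_trans (fM _ _)); exact: ltW.
Qed.

Lemma randomisation_expectation_fin {T : Type} {f : prodspace Z -> T -> R} (t : T) :
  randomisation X f -> 'E_P[fun w => f (X w) t] \is a fin_num.
Proof. by move=> Xf; apply/expectation_fin_num/Lfun1_integrable/randomisation_integrable. Qed.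

(** A non-empty index set matters here, since the supremum of the empty set is [-oo]; the points [z]
    and [a] exist because measurable types are pointed. *)
Lemma oscillation_ge0 {T : Type} (f : prodspace Z -> T -> R) (i : 'I_n) :
  inhabited T -> 0 <= oscillation f i.
Proof.
move=> [t]; apply: le_ereal_sup_tmp.
exists `|f (dfwith (point : prodspace Z) i point) t - f point t|%:E => //.
by exists t, point, point.
Qed.

Lemma deviation_ge0 {T : Type} (f : prodspace Z -> T -> R) z :
  inhabited T -> 0 <= deviation X f z.
Proof.
move=> [t]; apply: le_ereal_sup_tmp.
by exists `|(f z t)%:E - 'E_P[fun w => f (X w) t]| => //; exists t.
Qed.

Section affine.
Context {T : Type} (f g : prodspace Z -> T -> R) (a : R) (b : T -> R).
Hypotheses (a0 : (0 < a)%R) (gE : forall z t, g z t = (a * (f z t - b t))%R).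

(** The shift [b] depends on the index only, so it cancels in every difference. *)
Lemma affine_oscillation (i : 'I_n) : oscillation g i = a%:E * oscillation f i.
Proof.
rewrite -ereal_sup_pZl//; congr ereal_sup; apply/seteqP; split => x.
  move=> [t [u [z ->]]].
  exists `|f (dfwith z i u) t - f z t|%:E; first by exists t, u, z.
  rewrite -EFinM -{1}(gtr0_norm a0) -normrM !gE -mulrBr; congr (`| _ * _ |%:E)%R.
  by rewrite opprB addrA subrK.
move=> [_ [t [u [z ->]]] <-]; exists t, u, z.
rewrite -EFinM -{1}(gtr0_norm a0) -normrM !gE -mulrBr; congr (`| _ * _ |%:E)%R.
by rewrite opprB addrA subrK.
Qed.

Lemma affine_sample_size : sample_size g = (a ^- 2)%:E * sample_size f.
Proof.
rewrite /sample_size.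
have -> : \sum_(i < n) oscillation g i ^+ 2 =
    (a ^+ 2)%:E * \sum_(i < n) oscillation f i ^+ 2.
  rewrite ge0_sume_distrr; last by move=> i _; rewrite sqre_ge0.
  by apply: eq_bigr => i _; rewrite affine_oscillation !expe2 muleACA -EFinM.
have a20 : (0 < a ^+ 2)%R by rewrite exprn_gt0.
(* Inversion in [\bar R] is multiplicative only under a side condition on zero and infinite factors;
   it holds because [a ^+ 2] is finite and positive. *)
rewrite inveM; first by rewrite inver gt_eqF.
by rewrite inveM_defE eqe gt_eqF//= lee_fin lte_fin ltW a20// ltry !implybT.
Qed.

(** Sections of a randomisation are integrable, so the mean undergoes the same affine change as the
    value and the shift cancels between the two. *)
Lemma affine_deviation z : randomisation X f ->
  deviation X g z = a%:E * deviation X f z.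
Proof.
move=> Xf; rewrite -ereal_sup_pZl//; congr ereal_sup; rewrite image_comp.
apply: eq_imagel => t _ /=.
have EfE := fineK (randomisation_expectation_fin t Xf).
have iXf := randomisation_integrable t Xf.
have -> : 'E_P[fun w => g (X w) t] =
    a%:E * ('E_P[fun w => f (X w) t] - (b t)%:E).
  rewrite -(expectation_cst P (b t)) -expectationB; last 2 first.
  - exact/Lfun1_integrable.
  - exact: Lfun_cst.
  rewrite -expectationZl; last first.
    apply: rpredB; last exact: Lfun_cst.
    exact/Lfun1_integrable.
  by congr expectation; apply/funext => w /=; rewrite gE mulrC.
rewrite -EfE gE -!(EFinB, EFinM) /= -{3}(gtr0_norm a0) -normrM.
by rewrite -mulrBr opprB addrA subrK.
Qed.

Lemma affine_randomisation (M : R) : (forall t, `|b t| <= M)%R ->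
  randomisation X f -> randomisation X g.
Proof.
move=> bM [? [N fN] mf ?]; split => //.
  exists (a * (N + M))%R => z t.
  rewrite gE normrM gtr0_norm// ler_pM2l// (le_trans (ler_normB _ _))//.
  exact: lerD.
move=> t; rewrite (_ : (fun z => _) = (fun z => a * (f z t - b t)))%R.
  by apply: measurable_funM => //; apply: measurable_funB.
by apply/funext => z; rewrite gE.
Qed.

End affine.

(** The factor [a] of the deviation cancels against the factor [a^-1] of the root of the sample
    size. This also holds for infinite sample sizes, so the second alternative of [equivalent]
    always serves. *)
Lemma equivalent_scale {T U : Type} (f : prodspace Z -> T -> R)
    (g : prodspace Z -> U -> R) (a : R) : (0 < a)%R ->
  randomisation X f -> randomisation X g ->
  sample_size g = (a ^- 2)%:E * sample_size f ->
  (forall z, deviation X g z = a%:E * deviation X f z) ->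
  equivalent X f g.
Proof.
move=> a0 Xf Xg gf Dgf; split => //; right => z.
rewrite gf Dgf sqrteM ?lee_fin ?invr_ge0 ?sqr_ge0//.
have -> : sqrte (a ^- 2)%:E = a^-1%:E.
  by rewrite /= -exprVn sqrtr_sqr gtr0_norm ?invr_gt0.
by rewrite muleACA -EFinM mulVf ?gt_eqF// mul1e.
Qed.

End randomisations.

(** * Extension of monotone randomised functions to the real line *)

(** A quantity monotone in [phi] converges along such a sequence to its supremum over the indices
    below level [x], so one sequence serves for all [z] at once. *)
Lemma cofinal_sequence {R : realType} {T : Type} {phi : T -> R} {x : R} :
  (exists t, (phi t <= x)%R) ->
  exists u : nat -> T, (forall k, (phi (u k) <= x)%R) /\
    forall t, (phi t <= x)%R -> \forall k \near \oo, (phi t <= phi (u k))%R.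
Proof.
move=> [t0 t0x]; set S := [set phi t | t in [set t | (phi t <= x)%R]].
have supS : has_sup S.
  by split; [exists (phi t0), t0|exists x => _ [t tx <-]].
have le_sup t : (phi t <= x)%R -> (phi t <= sup S)%R.
  by move=> tx; apply: ub_le_sup; [case: supS|exists t].
(* If the supremum is attained, a constant sequence works. Otherwise every [phi t] lies strictly
   below it, and points within 1/(k+1) of it eventually pass [phi t]. *)
have [[t1 t1x t1S]|noS] := pselect (exists2 t, (phi t <= x)%R & phi t = sup S).
  exists (fun=> t1); split => // t tx; apply: nearW => _.
  by rewrite t1S; exact: le_sup.
have /choice[u uP] (k : nat) :
    exists t, (phi t <= x)%R /\ (sup S - k.+1%:R^-1 < phi t)%R.
  have [|_ [t tx <-] ?] := @sup_adherent _ S k.+1%:R^-1%R _ supS.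
    by rewrite invr_gt0.
  by exists t.
exists u; split=> [k|t tx]; first by have [] := uP k.
have tS : (phi t < sup S)%R.
  by rewrite lt_neqAle le_sup// andbT; apply/eqP => tS; apply: noS; exists t.
have tS0 : (0 < sup S - phi t)%R by rewrite subr_gt0.
apply: filterS (near_infty_natSinv_lt (PosNum tS0)) => k /= kt.
by have [_ /ltW] := uP k; apply: le_trans; rewrite lerBrDl -lerBrDr ltW.
Qed.

Section extension.
Context {R : realType} {n : nat} {d : 'I_n -> measure_display}
  {Z : forall i, measurableType (d i)} {dW : measure_display}
  {W : measurableType dW} {P : probability W R} {X : {RV P >-> prodspace Z}}.
Context {T : Type} (h : prodspace Z -> T -> R) (phi : T -> R).
Hypotheses (Xh : randomisation X h) (h01 : forall z t, (0 <= h z t <= 1)%R)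
  (h_phi : forall z s t, (phi s <= phi t)%R -> (h z s <= h z t)%R).

(** Adjoining 0 keeps the set non-empty at levels below the whole range of [phi], and is harmless
    elsewhere because [h] is non-negative. *)
Let values z x := 0%R |` [set h z t | t in [set t | (phi t <= x)%R]].

Let f z x := sup (values z x).

Let values_sup z x : has_sup (values z x).
Proof.
split; first by exists 0%R; left.
by exists 1%R => _ [->//|[t _ <-]]; have /andP[] := h01 z t.
Qed.

Let f_ge z x y : values z x y -> (y <= f z x)%R.
Proof. by apply: ub_le_sup; case: (values_sup z x). Qed.

Let f01 z x : (0 <= f z x <= 1)%R.
Proof.
rewrite f_ge; last by left.
apply: ge_sup; first by exists 0%R; left.
by move=> _ [->//|[t _ <-]]; have /andP[] := h01 z t.
Qed.

Let f_homo z : {homo f z : x y / (x <= y)%R}.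
Proof.
move=> x y xy; apply: ge_sup; first by exists 0%R; left.
move=> _ [->|[t /= tx <-]]; apply: f_ge; [by left|right].
by exists t => //=; exact: le_trans xy.
Qed.

Let f_phi z t : f z (phi t) = h z t.
Proof.
apply/eqP; rewrite eq_le [X in _ && X]f_ge ?andbT; last by right; exists t => /=.
apply: ge_sup; first by exists 0%R; left.
by move=> _ [->|[s /= st <-]]; [have /andP[] := h01 z t|exact: h_phi].
Qed.

(* The approximating sequence does not depend on [z]; measurability, means and
   oscillations therefore pass from [h] to [f]. *)
Let f_lim x : (forall z, f z x = 0%R) \/
  exists u : nat -> T, forall z, h z (u k) @[k --> \oo] --> f z x.
Proof.
have [tx|notx] := pselect (exists t, (phi t <= x)%R); [right|left => z].
  have [u [ux uP]] := cofinal_sequence tx.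
  exists u => z; apply/cvgrPdist_lt => e e0.
  have [y yz ey] := sup_adherent e0 (values_sup z x).
  (* If the nearly maximal value [y] is the adjoined 0, any index below level [x] dominates it. *)
  have [t [tlex yt]] : exists t, (phi t <= x)%R /\ (y <= h z t)%R.
    case: yz => [->|[t tlex <-]]; last by exists t.
    by case: tx => t tlex; exists t; split=> //; have /andP[] := h01 z t.
  apply: filterS (uP _ tlex) => k tk.
  rewrite ger0_norm; last by rewrite subr_ge0; apply: f_ge; right; exists (u k) => /=.
  rewrite ltrBlDl -ltrBlDr (lt_le_trans ey)// (le_trans yt)//.
  exact: h_phi.
rewrite /f (_ : values z x = [set 0%R]) ?sup1//.
by apply: setUidl => _ [t /= tx <-]; exfalso; apply: notx; exists t.
Qed.

Let Xf : randomisation X f.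
Proof.
have [iT _ mh Xind] := Xh; split => //.
- exact: inhabits 0%R.
- by exists 1%R => z x; have /andP[f0 f1] := f01 z x; rewrite ger0_norm.
- move=> x; have [f0|[u hu]] := f_lim x.
    by rewrite (_ : (fun z => _) = cst 0%R)//; exact/funext.
  by apply: (measurable_fun_cvg (h := fun k z => h z (u k))) => // z _; exact: hu.
Qed.

Let f_oscillation i : oscillation f i = oscillation h i.
Proof.
apply/eqP; rewrite eq_le; apply/andP; split; apply: ge_ereal_sup.
- move=> _ [x [a [z ->]]]; have [f0|[u hu]] := f_lim x.
    rewrite !f0 subrr normr0; apply: oscillation_ge0; by case: Xh.
  have : `|h (dfwith z i a) (u k) - h z (u k)|%:E @[k --> \oo] -->
         `|f (dfwith z i a) x - f z x|%:E.
    by apply: cvg_EFin; [exact: nearW|]; apply: cvg_norm; apply: cvgB; exact: hu.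
  move/cvge_to_le; apply; apply: nearW => k.
  by apply: ereal_sup_ubound; exists (u k), a, z.
- move=> _ [t [a [z ->]]]; rewrite -!f_phi.
  by apply: ereal_sup_ubound; exists (phi t), a, z.
Qed.

(** One inequality passes to the limit along [f_lim], the means converging by dominated convergence;
    the other holds because [f] restricts to [h] along [phi]. *)
Let f_deviation z : deviation X f z = deviation X h z.
Proof.
apply/eqP; rewrite eq_le; apply/andP; split; apply: ge_ereal_sup.
- move=> _ [x _ <-]; have [f0|[u hu]] := f_lim x.
    rewrite (_ : (fun w => _) = cst 0%R); last by apply/funext => w.
    rewrite expectation_cst f0 sube0 abse0.
    by apply: deviation_ge0; case: Xh.
  have EhEf : 'E_P[fun w => h (X w) (u k)] @[k --> \oo] --> 'E_P[fun w => f (X w) x].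
    rewrite unlock; apply: (@dominated_cvg _ _ _ P setT _ _ _ (cst 1)) => //.
    - by move=> k; have /integrableP[] := randomisation_integrable (u k) Xh.
    - by move=> w _; apply: cvg_EFin; [exact: nearW|exact: hu].
    - by apply: finite_measure_integrable_cst.
    - move=> k w _; rewrite lee_fin; have /andP[h0 h1] := h01 (X w) (u k).
      by rewrite ger0_norm.
  have : `|(h z (u k))%:E - 'E_P[fun w => h (X w) (u k)]| @[k --> \oo] -->
         `|(f z x)%:E - 'E_P[fun w => f (X w) x]|.
    apply: cvg_abse; apply: cvgeB => //.
    by apply: cvg_EFin; [exact: nearW|exact: hu].
  move/cvge_to_le; apply; apply: nearW => k.
  by apply: ereal_sup_ubound; exists (u k).
- move=> _ [t _ <-]; apply: ereal_sup_ubound; exists (phi t) => //.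
  by rewrite f_phi; congr (`| _ - expectation _ _ |); apply/funext => w; rewrite f_phi.
Qed.

Lemma monotone_extension : exists f : prodspace Z -> R -> R,
  [/\ classM X f, forall i, oscillation f i = oscillation h i &
      forall z, deviation X f z = deviation X h z].
Proof. by exists f; split. Qed.

End extension.

(** * Total variation of charges, and the infimum of a family bounded from below *)

Section charges.
Context {R : realType} {dO : measure_display} {Omega : measurableType dO}.
Implicit Types (mu nu kappa s : {charge set Omega -> \bar R}) (A B : set Omega).

Lemma crestr0E s B (mB : measurable B) A : measurable A ->
  crestr0 s mB A = s (A `&` B).
Proof. by move=> mA; rewrite /crestr0 mem_set. Qed.

Lemma pasteE s1 s2 B (mB : measurable B) (mBC : measurable (~` B)) A :
  measurable A ->
  cadd (crestr0 s1 mB) (crestr0 s2 mBC) A = s1 (A `&` B) + s2 (A `&` ~` B).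
Proof. by move=> mA; congr (_ + _); exact: crestr0E. Qed.

Lemma charge_norm_fin_num mu : charge_norm mu \is a fin_num.
Proof. exact: fin_num_measure. Qed.

Lemma charge_norm_ge0 mu : 0 <= charge_norm mu.
Proof. exact: measure_ge0. Qed.

Lemma abse_charge_le_norm mu A : measurable A -> `|mu A| <= charge_norm mu.
Proof.
move=> mA; apply: (le_trans (abse_charge_variation (hahn_pos_neg mu) mA)).
by apply: le_measure => //; rewrite inE.
Qed.

(** The negative Hahn set of such a charge is null, so only the positive part contributes. *)
Lemma charge_norm_nonneg mu : (forall A, measurable A -> 0 <= mu A) ->
  charge_norm mu = mu setT.
Proof.
move=> mu0; have [[mP _] [mN Nle0] PN PN0] := hahn_pos_neg mu.
have muN : mu (hahn_neg mu) = 0.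
  by apply/eqP; rewrite eq_le mu0// andbT Nle0.
rewrite /charge_norm /charge_variation /= jordan_posE jordan_negE.
rewrite cjordan_posE cjordan_negE !crestr0E// !setTI.
by rewrite muN oppe0 adde0 -PN chargeU// muN adde0.
Qed.

(** Only finite additivity is assumed, so that the identity applies both to charges and to a set
    function not yet known to be countably additive. The induction moves [F k] out of the tail. *)
Lemma tail_decomposition (m : set Omega -> \bar R) (F : (set Omega)^nat) k :
  additive2 m -> (forall i, measurable (F i)) -> trivIset setT F ->
  m (\bigcup_i F i) =
    \sum_(0 <= i < k) m (F i) + m (\bigcup_(i in [set i | (k <= i)%N]) F i).
Proof.
move=> addm mF tF; elim: k => [|k IHk].
  by rewrite big_nil add0e; congr m; apply: eq_bigcupl.
rewrite IHk big_nat_recr//= -addeA; congr (_ + _).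
rewrite -addm//; last 2 first.
- exact: bigcup_measurable.
- rewrite setI_bigcupr bigcup0// => i /= ki.
  by move/trivIsetP : tF; apply => //; rewrite ltn_eqF.
congr m; apply/seteqP; split => [x [i /= ki Fix]|x [Fkx|[i /= ki Fix]]].
- move: ki; rewrite leq_eqVlt => /predU1P[->|ki]; [by left|right].
  by exists i.
- by exists k => /=.
- by exists i => //=; exact: ltnW.
Qed.

Lemma sandwiched_fin_num kappa mu A (x : \bar R) : measurable A ->
  kappa A <= x <= mu A -> x \is a fin_num.
Proof.
move=> mA /andP[kx xm]; rewrite fin_numElt (lt_le_trans _ kx) ?(le_lt_trans xm)//.
- by rewrite ltey_eq fin_num_measure.
- by rewrite ltNye_eq fin_num_measure.
Qed.

(* Finite additivity reduces the claim to the tails, which are squeezed between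
   those of the two charges. *)
Lemma sandwiched_sigma_additive (m : set Omega -> \bar R) kappa mu :
  additive2 m -> (forall A, measurable A -> kappa A <= m A <= mu A) ->
  semi_sigma_additive m.
Proof.
move=> addm km F mF tF mUF; pose T k := \bigcup_(i in [set i | (k <= i)%N]) F i.
have mT k : measurable (T k) by exact: bigcup_measurable.
have finm A : measurable A -> m A \is a fin_num.
  by move=> mA; exact: sandwiched_fin_num mA (km A mA).
(* The tail value is the total minus a partial sum, and [s] is countably additive. *)
have T0 s : s (T k) @[k --> \oo] --> 0.
  have -> : (fun k => s (T k)) =
      (fun k => s (\bigcup_i F i) - \sum_(0 <= i < k) s (F i)).
    apply/funext => k; rewrite (tail_decomposition k (chargeU s) mF tF).
    by rewrite [X in _ = X - _]addeC addeK// //; apply/sum_fin_numP => i _ _; exact: fin_num_measure.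
  rewrite -[X in _ --> X](subee (fin_num_measure s _ mUF)); apply: cvgeB => //.
  - by rewrite fin_num_adde_defr// fin_num_measure.
  - exact: cvg_cst.
  - exact: charge_semi_sigma_additive.
have mT0 : m (T k) @[k --> \oo] --> 0.
  apply: squeeze_cvge (T0 kappa) (T0 mu).
  by apply: nearW => k; exact: km.
have -> : (fun k => \sum_(0 <= i < k) m (F i)) =
    (fun k => m (\bigcup_i F i) - m (T k)).
  apply/funext => k; rewrite (tail_decomposition k addm mF tF) addeK//.
  exact: finm (mT k).
rewrite -[X in _ --> X]sube0; apply: cvgeB => //; last exact: cvg_cst.
by rewrite fin_num_adde_defr// finm.
Qed.

Section infimum.
Context {I : Type} (mu : I -> {charge set Omega -> \bar R}).

(** Near-minimisers on two disjoint sets combine into a single member of this closure, which the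
    bare family does not offer. *)
Inductive pasting : {charge set Omega -> \bar R} -> Prop :=
| pasting_base i : pasting (mu i)
| pasting_step B (mB : measurable B) (mBC : measurable (~` B)) s1 s2 :
    pasting s1 -> pasting s2 ->
    pasting (cadd (crestr0 s1 mB) (crestr0 s2 mBC)).

Definition pasting_inf A : \bar R := ereal_inf [set s A | s in pasting].

(** In a pasting step, [kappa A] splits along [B] and its complement, and each piece is bounded by
    induction. *)
Lemma pasting_lower_bound kappa s :
  charge_lower_bound mu kappa -> pasting s -> charge_le kappa s.
Proof.
move=> kmu; elim=> [//|B mB mBC s1 s2 _ IH1 _ IH2] A mA.
rewrite [leRHS]pasteE//.
rewrite -[in leLHS](setIT A) -(setUv B) setIUr chargeU.
- by apply: leeD; [apply: IH1|apply: IH2]; exact: measurableI.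
- exact: measurableI.
- exact: measurableI.
- by rewrite setIACA setICr setI0.
Qed.

Lemma pasting_inf_le i A : pasting_inf A <= mu i A.
Proof. by apply: ereal_inf_lbound; exists (mu i) => //; exact: pasting_base. Qed.

Lemma pasting_inf_ge kappa A : charge_lower_bound mu kappa -> measurable A ->
  kappa A <= pasting_inf A.
Proof.
move=> kmu mA; apply: le_ereal_inf_tmp => _ [s ps <-].
exact: pasting_lower_bound.
Qed.

(** Superadditivity comes from the additivity of each pasted charge, subadditivity from pasting
    near-minimisers. The bound [kappa] and the member [mu i] make the values finite. *)
Lemma pasting_inf_additive kappa (i : I) : charge_lower_bound mu kappa ->
  additive2 pasting_inf.
Proof.
move=> kmu A B mA mB AB.
have finp C : measurable C -> pasting_inf C \is a fin_num.
  move=> mC; apply: (sandwiched_fin_num (kappa := kappa) (mu := mu i) mC).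
  by rewrite pasting_inf_ge// pasting_inf_le.
apply/eqP; rewrite eq_le; apply/andP; split; last first.
  apply: le_ereal_inf_tmp => _ [s ps <-]; rewrite chargeU//.
  by apply: leeD; apply: ereal_inf_lbound; exists s.
apply/lee_addgt0Pr => e e0.
have e20 : (0 < e / 2)%R by rewrite divr_gt0.
have [_ [s1 ps1 <-] s1A] := lb_ereal_inf_adherent e20 (finp A mA).
have [_ [s2 ps2 <-] s2B] := lb_ereal_inf_adherent e20 (finp B mB).
have mAC := measurableC mA.
apply: (@le_trans _ _ (s1 A + s2 B)).
  (* Pasting along [A] evaluates [s1] on [A] and [s2] on [B], since the part of the union outside
     [A] is [B]. *)
  apply: ereal_inf_lbound; exists (cadd (crestr0 s1 mA) (crestr0 s2 mAC)).
    exact: pasting_step.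
  rewrite [LHS]pasteE; last exact: measurableU.
  rewrite setIUl setIid (setIC B A) AB setU0 setIUl setICr set0U.
  by congr (_ + s2 _); apply/setIidl; apply/disjoints_subset; rewrite setIC.
apply: (le_trans (leeD (ltW s1A) (ltW s2B))).
by rewrite addeACA -EFinD -splitr.
Qed.

Lemma charge_inf_exists (i : I) : (exists kappa, charge_lower_bound mu kappa) ->
  exists nu, charge_inf mu nu.
Proof.
move=> [kappa kmu].
have bnd A : measurable A -> kappa A <= pasting_inf A <= mu i A.
  by move=> mA; rewrite pasting_inf_ge// pasting_inf_le.
have nu0 : pasting_inf set0 = 0.
  by apply/eqP; rewrite eq_le andbC; have := bnd _ measurable0; rewrite !charge0.
have nufin A : measurable A -> pasting_inf A \is a fin_num.
  by move=> mA; exact: sandwiched_fin_num mA (bnd A mA).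
have nusig := sandwiched_sigma_additive (pasting_inf_additive i kmu) bnd.
pose nu : {charge set Omega -> \bar R} := HB.pack pasting_inf
  (isCharge.Build _ _ _ pasting_inf nu0 nufin nusig).
exists nu; split=> [j A mA|lambda lmu A mA]; first exact: pasting_inf_le.
exact: pasting_inf_ge.
Qed.

End infimum.
End charges.

(** * Embedding of a regular chain in the line, and passage from cumulative functions to the
    class *)

(** If the inclusion went the other way for distinct indices, the symmetric difference would be
    [E s] minus [E t], and its positive mass would force [phi t < phi s]. *)
Lemma regular_chain_embedding {R : realType} {dO : measure_display}
    {Omega : measurableType dO} {T : Type} (E : T -> set Omega) :
  regular_chain R E ->
  exists phi : T -> R, forall s t, (phi s <= phi t)%R -> E s `<=` E t.
Proof.
move=> [mE chainE [lambda [finl lpos]]].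
exists (fun t => fine (lambda (E t))) => s t st.
have [//|Ets] := chainE s t.
have [->//|/lpos] := pselect (s = t).
have -> : E s `+` E t = E s `\` E t.
  by rewrite /setY (_ : E t `\` E s = set0) ?setU0// setD_eq0.
rewrite measureD//; last by rewrite ltey_eq finl.
rewrite setIidr// -(fineK (finl _ (mE s))) -(fineK (finl _ (mE t))).
by rewrite -EFinB lte_fin subr_gt0 ltNge st.
Qed.

Section cumulative_functions.
Context {R : realType} {n : nat} {d : 'I_n -> measure_display}
  {Z : forall i, measurableType (d i)} {dW : measure_display}
  {W : measurableType dW} {P : probability W R} {X : {RV P >-> prodspace Z}}
  {dO : measure_display} {Omega : measurableType dO}.

Lemma randomisation_cumulative {T : Type} (E : T -> set Omega)
    (mu : prodspace Z -> {charge set Omega -> \bar R}) :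
  independent_components X -> cumulative_setting E mu ->
  randomisation X (cumulative_function E mu).
Proof.
move=> indX [iT [mE _ _] _ mu1 mF]; split => //; exists 1%R => z t.
rewrite -lee_fin -abse_EFin fineK ?fin_num_measure//.
exact: le_trans (abse_charge_le_norm (mu z) (mE t)) (mu1 z).
Qed.

Lemma cumulative_equivalent_classM {T : Type} (E : T -> set Omega)
    (mu : prodspace Z -> {charge set Omega -> \bar R}) :
  independent_components X -> cumulative_setting E mu ->
  exists nu : {charge set Omega -> \bar R}, charge_inf mu nu /\
  exists f : prodspace Z -> R -> R,
    [/\ classM X f,
        equivalent X (cumulative_function E mu) f &
        sample_size f =
          (1 + charge_norm nu) ^+ 2 * sample_size (cumulative_function E mu)].
Proof.
move=> indX setE; have XF := randomisation_cumulative indX setE.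
have [iT rE kmu mu1 mF] := setE.
have [mE chainE _] := rE.
have [nu nuP] := charge_inf_exists (point : prodspace Z) kmu.
exists nu; split => //; have [nule _] := nuP.
have [phi phiP] := regular_chain_embedding rE.
(* [C] bounds [F z t - b t], as the two terms are at most 1 and the norm of [nu] in absolute value.
   Dividing by it gives values in [0, 1] and the factor in the sample size. *)
pose C := (1 + fine (charge_norm nu))%R.
have CE : C%:E = 1 + charge_norm nu by rewrite EFinD fineK// charge_norm_fin_num.
have C1 : (1 <= C)%R by rewrite lerDl fine_ge0// charge_norm_ge0.
have C0 : (0 < C)%R by exact: lt_le_trans C1.
have V0 : (0 < C^-1)%R by rewrite invr_gt0.
pose b t := fine (nu (E t)).
pose F := cumulative_function E mu.
pose h z t := (C^-1 * (F z t - b t))%R.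
have hE z t : h z t = (C^-1 * (F z t - b t))%R by [].
have bM t : (`|b t| <= fine (charge_norm nu))%R.
  rewrite -lee_fin fineK ?charge_norm_fin_num// -abse_EFin fineK ?fin_num_measure//.
  exact: abse_charge_le_norm.
have Xh : randomisation X h := affine_randomisation V0 hE bM XF.
have h01 z t : (0 <= h z t <= 1)%R.
  apply/andP; split.
    rewrite mulr_ge0 ?(ltW V0)// subr_ge0 fine_le ?fin_num_measure//.
    exact: nule.
  rewrite ler_pdivrMl// mulr1 lerD//.
    rewrite -lee_fin fineK ?fin_num_measure//.
    apply: le_trans (lee_abs _) _.
    exact: le_trans (abse_charge_le_norm (mu z) (mE t)) (mu1 z).
  by apply: le_trans (bM t); rewrite -normrN ler_norm.
(* The increment is, up to the factor [C^-1], the value on [E t] minus [E s] of the charge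
   [mu z - nu], which is non-negative. *)
have h_phi z s t : (phi s <= phi t)%R -> (h z s <= h z t)%R.
  move=> /phiP Est; rewrite ler_pM2l// -subr_ge0.
  have D (m : {charge set Omega -> \bar R}) :
      fine (m (E t `\` E s)) = (fine (m (E t)) - fine (m (E s)))%R.
    by rewrite chargeD// setIidr// fineB// fin_num_measure.
  have -> : (F z t - b t - (F z s - b s) =
      fine (mu z (E t `\` E s)) - fine (nu (E t `\` E s)))%R.
    by rewrite !D /F /b /cumulative_function; ring.
  have mD : measurable (E t `\` E s) by exact: measurableD.
  by rewrite subr_ge0 fine_le ?fin_num_measure//; exact: nule.
have [f [fM fosc fdev]] := monotone_extension Xh h01 h_phi.
have sfh : sample_size f = sample_size h.
  by congr inve; apply: eq_bigr => i _; rewrite fosc.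
have sF : sample_size f = (C^-1 ^- 2)%:E * sample_size F.
  by rewrite sfh (affine_sample_size V0 hE).
exists f; split => //; last first.
  by rewrite sF -CE exprVn invrK.
apply: (equivalent_scale V0) => // [|z]; first by case: fM.
by rewrite fdev (affine_deviation V0 hE z XF).
Qed.

End cumulative_functions.

(** * A disjoint union of lines with Lebesgue measure on the unit interval of each fibre *)

Section fibred_space.
Context {R : realType} {I : pointedType}.

(** The final sigma-algebra for the inclusions of the fibres. No condition links different fibres,
    so subgraphs are measurable for arbitrary [q], even over an uncountable [I]. *)
Definition fibrewise : set (set (I * measurableTypeR R)) :=
  [set A | forall i, measurable [set x | A (i, x)]].

Definition fibred := g_sigma_algebraType fibrewise.

(** [fibrewise] is already a sigma-algebra, so generating adds no sets. *)
Lemma measurable_fibredE (A : set fibred) :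
  measurable A = (forall i, measurable [set x : measurableTypeR R | A (i, x)]).
Proof.
rewrite [X in X A]measurable_g_measurableTypeE//; split => /=.
- by move=> i; exact: measurable0.
- by move=> B mB i; rewrite setTD; exact: measurableC (mB i).
- by move=> B mB i; apply: (bigcup_measurable (P := setT)) => k _; exact: mB.
Qed.

(** The cut to [0, 1] keeps the mass at most 1, for the norm bound on the charges. *)
Definition fibre_measure (i : I) (A : set fibred) : \bar R :=
  lebesgue_measure ([set x | A (i, x)] `&` `[0%R, 1%R]).

Section fibre_measure.
Variable i : I.

Let fibre_measure0 : fibre_measure i set0 = 0.
Proof. by rewrite /fibre_measure set0I measure0. Qed.

Let fibre_measure_ge0 A : 0 <= fibre_measure i A.
Proof. exact: measure_ge0. Qed.

Let fibre_measure_sigma_additive : semi_sigma_additive (fibre_measure i).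
Proof.
move=> F mF tF _; rewrite /fibre_measure.
have -> : [set x | (\bigcup_k F k) (i, x)] = \bigcup_k [set x | F k (i, x)] by [].
rewrite setI_bigcupl.
have mFk k : measurable ([set x | F k (i, x)] `&` `[0%R, 1%R] : set (measurableTypeR R)).
  by apply: measurableI => //; have := mF k; rewrite measurable_fibredE.
apply: measure_semi_sigma_additive => //; last exact: bigcup_measurable.
apply/trivIsetP => j k _ _ jk; rewrite setIACA setIid.
move/trivIsetP : tF => /(_ j k Logic.I Logic.I jk) Fjk.
rewrite (_ : _ `&` _ = set0) ?set0I//; apply/seteqP; split => // x /= [Fj Fk].
by have : (F j `&` F k) (i, x) by []; rewrite Fjk.
Qed.

HB.instance Definition _ := isMeasure.Build _ _ _ (fibre_measure i)
  fibre_measure0 fibre_measure_ge0 fibre_measure_sigma_additive.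

Lemma fibre_measure_le1 A : measurable A -> fibre_measure i A <= 1.
Proof.
rewrite measurable_fibredE => mA.
apply: (@le_trans _ _ (lebesgue_measure (`[0%R, 1%R] : set (measurableTypeR R)))).
  apply: le_measure; rewrite ?inE//; first exact: measurableI.
by rewrite lebesgue_measure_itv/= lte_fin ltr01 sube0.
Qed.

Let fibre_measure_fin : fin_num_fun (fibre_measure i).
Proof.
move=> A mA; rewrite ge0_fin_numE//.
exact: le_lt_trans (fibre_measure_le1 mA) (ltry 1).
Qed.

HB.instance Definition _ := Measure_isFinite.Build _ _ _ (fibre_measure i)
  fibre_measure_fin.

End fibre_measure.

Definition subgraph (q : I -> R) : set fibred := [set p | (0 <= p.2 < q p.1)%R].

Lemma subgraph_section q i :
  [set x | subgraph q (i, x)] = [set` `[0%R, q i[].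
Proof. by apply/seteqP; split => x /=; rewrite in_itv. Qed.

Lemma measurable_subgraph q : measurable (subgraph q).
Proof. by rewrite measurable_fibredE => i; rewrite subgraph_section. Qed.

Lemma subgraphS q r : (forall i, q i <= r i)%R -> subgraph q `<=` subgraph r.
Proof. by move=> qr [i x] /= /andP[x0 xq]; rewrite /subgraph/= x0 (lt_le_trans xq). Qed.

Lemma fibre_measure_subgraph q i : (0 <= q i <= 1)%R ->
  fibre_measure i (subgraph q) = (q i)%:E.
Proof.
move=> /andP[q0 q1]; rewrite /fibre_measure subgraph_section setIidl.
  by rewrite lebesgue_measure_itv/= lte_fin; case: ltgtP q0 => // [|<-]; rewrite ?sube0.
by move=> x /=; rewrite !in_itv/= => /andP[-> /ltW /le_trans ->].
Qed.

End fibred_space.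
Arguments fibred : clear implicits.

(** * The logistic function, a strictly increasing map into the unit interval *)

Section logistic.
Context {R : realType}.

Definition logistic (t : R) : R := (1 + expR (- t))^-1.

Lemma logistic01 t : (0 <= logistic t <= 1)%R.
Proof.
have e0 : (0 <= expR (- t))%R by exact: expR_ge0.
by rewrite invr_ge0 addr_ge0//= invf_le1 ?lerDl// ltr_wpDr.
Qed.

Lemma logistic_lt : {mono logistic : s t / (s < t)%R}.
Proof.
have pos t : (0 < 1 + expR (- t) :> R)%R by rewrite ltr_wpDr ?expR_ge0.
move=> s t; rewrite ltf_pV2 ?posrE ?pos//.
by rewrite ltrD2l ltr_expR ltrN2.
Qed.

Lemma logistic_le : {mono logistic : s t / (s <= t)%R}.
Proof. by move=> s t; rewrite !leNgt logistic_lt. Qed.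

End logistic.

(** * Realisation of members of the class as cumulative functions *)

Section converse.
Context {R : realType} {n : nat} {d : 'I_n -> measure_display}
  {Z : forall i, measurableType (d i)} {dW : measure_display}
  {W : measurableType dW} {P : probability W R} {X : {RV P >-> prodspace Z}}.
Context (f : prodspace Z -> R -> R) (fM : classM X f).

Let Omega := fibred R (option (prodspace Z)).

Let q (t : R) (o : option (prodspace Z)) : R :=
  if o is Some z then f z t else logistic t.

Let E (t : R) : set Omega := subgraph (q t).

Let q01 t o : (0 <= q t o <= 1)%R.
Proof. by case: o => [z|] /=; [case: fM|exact: logistic01]. Qed.

Let q_homo o : {homo q^~ o : s t / (s <= t)%R}.
Proof. by case: o => [z|] s t st /=; [case: fM => _ _; apply|rewrite logistic_le]. Qed.

Let mE t : measurable (E t).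
Proof. exact: measurable_subgraph. Qed.

Let ES s t : (s <= t)%R -> E s `<=` E t.
Proof. by move=> st; apply: subgraphS => o; exact: q_homo. Qed.

Let fibre_measureE o t : fibre_measure o (E t) = (q t o)%:E.
Proof. by rewrite /E fibre_measure_subgraph. Qed.

(* The fibre over [None] separates the members of the chain. *)
Let rE : regular_chain R E.
Proof.
split=> [//|s t|].
  by have /orP[] := le_total s t => st; [left|right]; exact: ES.
exists (fibre_measure None); split=> [A mA|s t]; first exact: fin_num_measure.
have lt_pos r u : (r < u)%R -> 0 < fibre_measure None (E u `\` E r).
  move=> ru; rewrite measureD//; last by rewrite ltey_eq fin_num_measure.
  rewrite setIidr; last exact/ES/ltW.
  by rewrite /= !fibre_measureE/= -EFinB lte_fin subr_gt0 logistic_lt.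
move=> /eqP; rewrite neq_lt => /orP[st|ts].
- apply: (lt_le_trans (lt_pos s t st)); apply: le_measure; rewrite ?inE//.
  + exact: measurableD.
  + by apply: measurableU; exact: measurableD.
  + exact: subsetUr.
- apply: (lt_le_trans (lt_pos t s ts)); apply: le_measure; rewrite ?inE//.
  + exact: measurableD.
  + by apply: measurableU; exact: measurableD.
  + exact: subsetUl.
Qed.

Let m (z : prodspace Z) : {charge set Omega -> \bar R} := fibre_measure (Some z).

Lemma classM_equivalent_cumulative :
  exists (dO : measure_display) (Omega : measurableType dO)
    (Theta : Type) (E : Theta -> set Omega)
    (mu : prodspace Z -> {charge set Omega -> \bar R}),
    [/\ cumulative_setting E mu,
        charge_inf mu (@czero dO Omega R) &
        equivalent X f (cumulative_function E mu)].
Proof.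
have [Xf f01 _] := fM.
have m0 : charge_lower_bound m (@czero _ Omega R) by move=> z A mA; exact: measure_ge0.
(* The measures [m z] live on disjoint fibres, so this infimum is non-zero only when there is a
   single [z]; subtracting it treats all cases at once. *)
have [nu [num nu_max]] : exists nu, charge_inf m nu.
  by apply: (charge_inf_exists (point : prodspace Z)); exists czero.
have nu0 A : measurable A -> 0 <= nu A by exact: (nu_max czero).
have nu_fin A : measurable A -> nu A \is a fin_num by exact: fin_num_measure.
pose mu z : {charge set Omega -> \bar R} := cadd (m z) (copp nu).
have muE z A : mu z A = m z A - nu A by [].
have mu0 : charge_lower_bound mu (@czero _ Omega R).
  by move=> z A mA; rewrite muE sube_ge0 ?nu_fin//; exact: num.
pose b t := fine (nu (E t)).
(* Subtracting [nu] is an affine change with factor 1 and a shift that depends on the index only, so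
   sample size and deviation are those of [f]. *)
have FE z t : cumulative_function E mu z t = (1 * (f z t - b t))%R.
  by rewrite mul1r /cumulative_function muE fineB ?fin_num_measure// /m /= fibre_measureE.
have bM t : (`|b t| <= 1)%R.
  rewrite ger0_norm ?fine_ge0 ?nu0// -lee_fin fineK ?nu_fin//.
  exact: le_trans (num point _ (mE t)) (fibre_measure_le1 _ (mE t)).
have XF := affine_randomisation ltr01 FE bM Xf.
exists _, Omega, R, E, mu; split.
- split => //; [exact: inhabits 0%R|by exists czero| |by case: XF].
  (* As [mu z] is non-negative, its norm is its total mass, which is at most that of [m z]. *)
  move=> z; rewrite charge_norm_nonneg => [|A mA]; last exact: mu0.
  rewrite muE leeBlDr ?nu_fin//; apply: (le_trans (fibre_measure_le1 _ measurableT)).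
  by rewrite leeDl// nu0.
- split=> // kappa kmu A mA.
  (* Adding [nu] turns a lower bound of the [mu z] into one of the [m z], hence below [nu];
     cancelling [nu] leaves [kappa A <= 0]. *)
  have : cadd kappa nu A <= nu A.
    apply: nu_max => // z B mB; have := kmu z B mB.
    by rewrite muE leeBrDr ?nu_fin.
  by rewrite [leLHS]/(kappa A + nu A) -[leRHS]add0e leeD2rE ?nu_fin.
- apply: (equivalent_scale ltr01 Xf XF) => [|z].
    exact: affine_sample_size ltr01 FE.
  exact: affine_deviation ltr01 FE z Xf.
Qed.

End converse.

Theorem proposition2p10 (R : realType) :
  (forall (n : nat) (d : 'I_n -> measure_display)
      (Z : forall i, measurableType (d i))
      (dW : measure_display) (W : measurableType dW) (P : probability W R)
      (X : {RV P >-> prodspace Z})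
      (dO : measure_display) (Omega : measurableType dO)
      (Theta : Type) (E : Theta -> set Omega)
      (mu : prodspace Z -> {charge set Omega -> \bar R}),
    (0 < n)%N -> independent_components X -> cumulative_setting E mu ->
    exists nu : {charge set Omega -> \bar R}, charge_inf mu nu /\
    exists f : prodspace Z -> R -> R,
      [/\ classM X f,
          equivalent X (cumulative_function E mu) f &
          sample_size f =
            (1 + charge_norm nu) ^+ 2 * sample_size (cumulative_function E mu)]) /\
  (forall (n : nat) (d : 'I_n -> measure_display)
      (Z : forall i, measurableType (d i))
      (dW : measure_display) (W : measurableType dW) (P : probability W R)
      (X : {RV P >-> prodspace Z}) (f : prodspace Z -> R -> R),
    (0 < n)%N -> classM X f ->
    exists (dO : measure_display) (Omega : measurableType dO)
      (Theta : Type) (E : Theta -> set Omega)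
      (mu : prodspace Z -> {charge set Omega -> \bar R}),
      [/\ cumulative_setting E mu,
          charge_inf mu (@czero dO Omega R) &
          equivalent X f (cumulative_function E mu)]).
Proof.
split=> [n d Z dW W P X dO Omega Theta E mu _ indX setE|n d Z dW W P X f _ fM].
  exact: cumulative_equivalent_classM.
exact: classM_equivalent_cumulative.
Qed.
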